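(* Let $n\ge 2$ be an integer and let $\alpha=(x_1,\dots,x_n):[0,1]\to[0,1]^n$ be the $n$-dimensional Peano curve defined in the context. Then each coordinate function $x_i:[0,1]\to[0,1]$, $i=1,\dots,n$, is uniformly distributed: for every Lebesgue measurable set $A\subset[0,1]$, the set $x_i^{-1}(A)$ is Lebesgue measurable and $\mu(x_i^{-1}(A))=\mu(A)$, where $\mu$ is Lebesgue measure.
   Context: Fix an integer $n\ge 2$; $\mathbb{N}=\{1,2,3,\dots\}$. Let $D=\{0,1,2\}$ and let $\mathcal{S}_D$ be the set of all sequences $\mathbf{t}=(t_k)_{k\in\mathbb{N}}$ with $t_k\in D$. Let $\xi:D\to D$, $\xi(a)=2-a$, and let $\xi^m$ denote its $m$-fold iterate ($\xi^0=\mathrm{id}$). For $1\le i\le n$, $j\ge 0$ and $\mathbf{t}\in\mathcal{S}_D$ put $$S_{i+jn}(\mathbf{t})=\sum_{k=1}^{i+jn}t_k-\sum_{s=0}^{j}t_{i+sn}\quad(\text{a nonnegative integer}),\qquad x_i(\mathbf{t})=\sum_{j=0}^{\infty}\frac{\xi^{S_{i+jn}(\mathbf{t})}(t_{i+jn})}{3^{j+1}}\in[0,1].$$ Let $\Phi:\mathcal{S}_D\to[0,1]$, $\Phi(\mathbf{t})=\sum_{k\ge1}t_k/3^k$. An element $\mathbf{t}\in\Phi^{-1}(t)$ is called a ternary representation of $t\in[0,1]$. The value $x_i(\mathbf{t})$ is the same for all ternary representations $\mathbf{t}$ of a given $t$, so the function $x_i:[0,1]\to[0,1]$, $x_i(t):=x_i(\mathbf{t})$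 for any $\mathbf{t}\in\Phi^{-1}(t)$, is well defined. The map $\alpha=(x_1,\dots,x_n)$ is called the $n$-dimensional Peano curve. *)

(* Defs.v *)
From HB Require Import structures.
From mathcomp Require Import all_boot all_order all_algebra.
From mathcomp Require Import all_classical all_reals all_analysis.

Set Implicit Arguments.
Unset Strict Implicit.
Unset Printing Implicit Defensive.

Import Order.TTheory GRing.Theory Num.Theory.
Import numFieldNormedType.Exports.

Local Open Scope classical_set_scope.
Local Open Scope ring_scope.

(* Positions and coordinates are numbered from 0: [t k] is the digit $t_{k+1}$
   and [i : 'I_n] is the coordinate $i+1$, so that the digit $t_{i+jn}$ of the
   1-based numbering is [t (i + j * n)]. *)
Definition ternary_seq := nat -> 'I_3.

(* [rev_ord a] has value [3 - a.+1], that is $2 - a$. *)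
Definition xi : 'I_3 -> 'I_3 := @rev_ord 3.

Definition Phi (R : realType) (t : ternary_seq) : R :=
  limn (series (fun k => (t k)%:R / 3 ^+ k.+1 : R)).

(* The subtraction on [nat] is exact: the subtracted digits all occur in the
   first sum. *)
Definition S_ (n : nat) (i : 'I_n) (j : nat) (t : ternary_seq) : nat :=
  (\sum_(k < (i + j * n).+1) t k - \sum_(s < j.+1) t (i + s * n))%N.

Definition x_seq (R : realType) (n : nat) (i : 'I_n) (t : ternary_seq) : R :=
  limn (series (fun j =>
    (iter (S_ i j t) xi (t (i + j * n)%N))%:R / 3 ^+ j.+1 : R)).

Definition ternary_repr (R : realType) (t : R) : set ternary_seq :=
  [set s | Phi R s = t].

(* The value does not depend on the representation of [t] picked by [xget];
   the default sequence is used only when [t] is outside [0, 1]. *)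
Definition peano_curve (R : realType) (n : nat) (t : R) : 'rV[R]_n :=
  \row_(i < n) x_seq R i (xget (fun=> ord0) (ternary_repr t)).

(* The Lebesgue (not just Borel) measurable sets: the sigma-algebra on which
   [completed_lebesgue_measure] is defined. *)
Definition lebesgue_measurable (R : realType) : set (set R) :=
  (@wlength R idfun)^*%mu.-cara.-measurable.

(* [f] stands for a function on [0, 1]; its values elsewhere are irrelevant. *)
Definition uniformly_distributed (R : realType) (f : R -> R) : Prop :=
  forall A : set R, A `<=` `[0, 1] -> lebesgue_measurable A ->
    lebesgue_measurable (`[0, 1] `&` f @^-1` A) /\
    completed_lebesgue_measure (`[0, 1] `&` f @^-1` A) =
      completed_lebesgue_measure A.

(* Main.v *)
(* Cut the digits of a representation [s] of [t] after [m * n] places. The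
   first [m] digits of [x_i] are obtained by applying a power of [xi] to the
   digits of [s] in positions congruent to [i], with exponents that only depend
   on the other digits. Hence at most [3 ^ (m * (n - 1))] words of length [m * n]
   produce a given [m]-digit output. Each word confines [t] to an interval of
   length [3 ^- (m * n)], so letting [m] grow shows that the preimage of an
   interval under [f = x_i] has outer measure at most its length, whichever
   representations were picked; by countable covers, the outer measure of
   [f^-1 A] is at most that of [A], for every set [A].
   For measurable [A] in [I = [0, 1]], applying this to [A] and [I \ A] forces
   the outer measures of [E = f^-1 A] and [I \ E] to add up to 1, which yields
   both the measurability of [E] and the equality of measures. *)

Require Import Defs.
From mathcomp Require Import all_boot all_order all_algebra.
From mathcomp Require Import all_classical all_reals all_analysis.
From mathcomp Require Import measurable_realfun ring lra zify.

Set Implicit Arguments.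
Unset Strict Implicit.
Unset Printing Implicit Defensive.

Import Order.TTheory GRing.Theory Num.Theory.
Import numFieldNormedType.Exports.

Local Open Scope classical_set_scope.
Local Open Scope ring_scope.

(** * Ternary expansions and their prefixes *)

(** Divided by [3 ^ m], this integer is the [m]-th partial sum of [Phi]; words of length [m] are
    compared through it. *)
Fixpoint prefix_val (d : ternary_seq) (m : nat) : nat :=
  if m is m'.+1 then (3 * prefix_val d m' + d m')%N else 0%N.

Lemma prefix_val_inj (d e : ternary_seq) m :
  prefix_val d m = prefix_val e m -> forall k, (k < m)%N -> d k = e k.
Proof.
elim: m => // m IH /= de k; rewrite ltnS leq_eqVlt => /predU1P[->|km].
  by apply: val_inj => /=; have := ltn_ord (d m); have := ltn_ord (e m); lia.
by apply: IH km; have := ltn_ord (d m); have := ltn_ord (e m); lia.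
Qed.

Lemma eq_prefix_val (d e : ternary_seq) m :
  (forall k, (k < m)%N -> d k = e k) -> prefix_val d m = prefix_val e m.
Proof.
elim: m => //= m IH de; rewrite IH ?de// => k km.
by apply: de; exact: ltnW.
Qed.

Lemma ler_triadicP (R : realType) (x y c : R) :
  (forall m, x <= y + c / 3 ^+ m) -> x <= y.
Proof.
move=> xyc; have cvg3 : (fun m => y + c / 3 ^+ m) @ \oo --> y.
  rewrite -[X in _ --> X]addr0; apply: cvgD; first exact: cvg_cst.
  rewrite (_ : (fun m => c / 3 ^+ m) = geometric c 3^-1).
    by apply: cvg_geometric; rewrite ger0_norm// invf_lt1// ltr1n.
  by apply/funext => m /=; rewrite exprVn.
rewrite -(cvg_lim (@Rhausdorff R) cvg3); apply: limr_ge.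
  by apply/cvg_ex; exists y.
exact: nearW.
Qed.

Lemma series_prefix_val (R : realType) (d : ternary_seq) m :
  series (fun k => (d k)%:R / 3 ^+ k.+1 : R) m = (prefix_val d m)%:R / 3 ^+ m.
Proof.
elim: m => [|m IH]; first by rewrite /series/= big_geq// mul0r.
rewrite seriesSr IH /=.
by rewrite natrD natrM exprS; field; rewrite expf_neq0.
Qed.

(** The partial sums [u k] increase, while [u k + 3 ^- k] decreases because digits are at most 2;
    the limit lies between the two. *)
Lemma Phi_bounds (R : realType) (d : ternary_seq) m :
  (prefix_val d m)%:R / 3 ^+ m <= Phi R d <= (prefix_val d m).+1%:R / 3 ^+ m.
Proof.
set u := series (fun k => (d k)%:R / 3 ^+ k.+1 : R).
have d2 k : (d k)%:R <= 2 :> R by rewrite ler_nat -ltnS ltn_ord.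
have uS k : u k.+1 = u k + (d k)%:R / 3 ^+ k.+1.
  exact: seriesSr.
have ndu : nondecreasing_seq u.
  by apply/nondecreasing_seqP => k; rewrite uS lerDl divr_ge0.
have niu : nonincreasing_seq (fun k => u k + 3 ^- k).
  apply/nonincreasing_seqP => k; rewrite uS -addrA lerD2l.
  have ->: 3 ^- k = 3 * 3 ^- k.+1 :> R.
    by rewrite exprS; field; rewrite expf_neq0.
  have : 0 <= 3 ^- k.+1 :> R by rewrite invr_ge0.
  by have := d2 k; nra.
have ub k l : u l <= u k + 3 ^- k.
  have [kl|/ltnW lk] := leqP k l.
    by apply: le_trans (niu _ _ kl); rewrite lerDl invr_ge0.
  by apply: le_trans (ndu _ _ lk) _; rewrite lerDl invr_ge0.
have cu : cvgn u.
  apply: nondecreasing_is_cvgn => //; exists (u 0%N + 3 ^- 0).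
  by move=> _ [l _ <-].
apply/andP; split.
  by rewrite -series_prefix_val; exact: nondecreasing_cvgn_le.
rewrite -natr1 mulrDl mul1r -series_prefix_val; apply: limr_le => //.
by apply: nearW => l; exact: ub.
Qed.

Lemma Phi_surj (R : realType) (t : R) :
  0 <= t <= 1 -> exists d : ternary_seq, Phi R d = t.
Proof.
move=> t01.
(* Ties go to the smaller digit, so the remainders [r k] stay in the closed unit interval, and
   [t = 1] gets the digit 2 everywhere. *)
pose dig (r : R) : 'I_3 := if 3 * r <= 1 then inord 0 else
  if 3 * r <= 2 then inord 1 else inord 2.
pose r := fix r k := if k is k'.+1 then 3 * r k' - (dig (r k'))%:R else t.
pose d k := dig (r k).
have r01 k : 0 <= r k <= 1.
  elim: k => //= k; set x := r k; rewrite /dig => x01.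
  by case: ifPn => h1; [|case: ifPn => h2]; rewrite inordK//; lra.
have tE k : t = (prefix_val d k)%:R / 3 ^+ k + r k / 3 ^+ k.
  elim: k => [|k ->] /=; first by rewrite mul0r add0r divr1.
  rewrite natrD natrM exprS -/(d k); by field; rewrite expf_neq0.
exists d; apply/le_anti/andP; split; apply: (@ler_triadicP _ _ _ 1) => m.
  have /andP[_] := Phi_bounds R d m; rewrite -natr1 mulrDl (tE m).
  have := r01 m; have : 0 <= 3 ^- m :> R by rewrite invr_ge0.
  set p := (prefix_val _ _)%:R; nra.
have /andP[+ _] := Phi_bounds R d m; rewrite (tE m).
have := r01 m; have : 0 <= 3 ^- m :> R by rewrite invr_ge0.
set p := (prefix_val _ _)%:R; nra.
Qed.

(** * Dependence of the output digits on the input digits *)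

(* The ternary digits of [x_seq R i t]. *)
Definition out_digits n (i : 'I_n) (t : ternary_seq) : ternary_seq :=
  fun j => iter (S_ i j t) xi (t (i + j * n)%N).

Lemma sum_nat_last (P : pred nat) (F : nat -> nat) c p : (c <= p)%N -> P p ->
  (forall k, (c <= k < p)%N -> ~~ P k) ->
  (\sum_(c <= k < p.+1 | P k) F k = F p)%N.
Proof.
move=> cp Pp nP; rewrite big_mkcond big_nat_recr//= Pp big_nat big1//.
by move=> k /nP/negbTE->.
Qed.

(** The subtracted digits are those at positions congruent to [i] modulo [n], so the exponent only
    sees the digits off that residue class. *)
Lemma S_E n (i : 'I_n) j (t : ternary_seq) :
  S_ i j t = (\sum_(0 <= k < (i + j * n).+1 | (k %% n != i)%N) t k)%N.
Proof.
rewrite /S_ -[X in (X - _)%N](big_mkord xpredT (fun k => t k : nat)).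
rewrite (bigID (fun k => (k %% n == i)%N))/=.
suff -> : (\sum_(0 <= k < (i + j * n).+1 | (k %% n == i)%N) t k =
           \sum_(s < j.+1) t (i + s * n))%N by rewrite addKn.
elim: j => [|j IH].
  rewrite big_ord_recl big_ord0 addn0 mul0n addn0 sum_nat_last//.
    by rewrite modn_small.
  move=> k /= ki; rewrite modn_small ?ltn_eqF//.
  exact: ltn_trans (ltn_ord i).
rewrite big_ord_recr/= -IH (@big_cat_nat _ _ _ (i + j * n).+1)//=; last first.
  by rewrite ltnS leq_add2l leq_mul2r leqnSn orbT.
congr addn; rewrite sum_nat_last//.
- by have := ltn_ord i; rewrite mulSn; lia.
- by rewrite addnC modnMDl modn_small.
(* Otherwise the quotient of [k] by [n] would lie strictly between [j] and [j.+1]. *)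
move=> k /andP[jk kj]; apply/negP => /eqP ki.
have := divn_eq k n; rewrite ki => kE.
have : (j * n < (k %/ n) * n)%N by lia.
have : ((k %/ n) * n < j.+1 * n)%N by lia.
by rewrite !ltn_mul2r => /andP[_ +] /andP[_ +]; lia.
Qed.

Lemma iter_xi_inj k : injective (iter k xi).
Proof.
have xi_inj : injective xi := can_inj (@rev_ordK 3).
by elim: k => // k IH x y /= /xi_inj/IH.
Qed.

Lemma S_congr n (i : 'I_n) j (s t : ternary_seq) :
  (forall k, (k <= i + j * n)%N -> (k %% n != i)%N -> s k = t k) ->
  S_ i j s = S_ i j t.
Proof.
move=> st; rewrite !S_E big_nat_cond [RHS]big_nat_cond.
by apply: eq_bigr => k /andP[/andP[_ ki] kn]; rewrite st.
Qed.

Lemma ltn_pos n (i : 'I_n) j m : (j < m)%N -> (i + j * n < m * n)%N.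
Proof. by move=> jm; have := ltn_ord i; nia. Qed.

Lemma out_digits_congr n (i : 'I_n) m (s t : ternary_seq) :
  (forall k, (k < m * n)%N -> s k = t k) ->
  forall j, (j < m)%N -> out_digits i s j = out_digits i t j.
Proof.
move=> st j jm; have jn := ltn_pos i jm; rewrite /out_digits (st _ jn).
congr (iter _ _ _); apply: S_congr => k kj _; apply: st.
exact: leq_ltn_trans kj jn.
Qed.

(** Agreement off the residue class of [i] makes the exponents equal, and iterates of [xi] are
    injective, so equal outputs force equal digits on that class too. *)
Lemma out_digits_inj n (i : 'I_n) m (s t : ternary_seq) :
  (forall k, (k < m * n)%N -> (k %% n != i)%N -> s k = t k) ->
  (forall j, (j < m)%N -> out_digits i s j = out_digits i t j) ->
  forall k, (k < m * n)%N -> s k = t k.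
Proof.
move=> st ost k km; have [ki|] := eqVneq (k %% n)%N (i : nat); last exact: st.
have kE : k = (i + k %/ n * n)%N by rewrite -ki addnC -divn_eq.
have jm : (k %/ n < m)%N by have := ltn_ord i; nia.
have := ost _ jm; rewrite /out_digits -kE (@S_congr _ _ _ s t).
  exact: iter_xi_inj.
by move=> l li; apply: st; apply: leq_ltn_trans li _; exact: ltn_pos.
Qed.

(** * Counting words with prescribed output *)

Definition word_seq L (w : {ffun 'I_L -> 'I_3}) : ternary_seq :=
  fun k => oapp w ord0 (insub k).

Lemma word_seqE L (w : {ffun 'I_L -> 'I_3}) (k : 'I_L) : word_seq w k = w k.
Proof. by rewrite /word_seq valK. Qed.

(** In dimension [n.+1], a word is determined by its output, which takes at most [K.+1] values, and
    by its [m * n] digits off coordinate [i], which [lift i] enumerates. *)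
Lemma card_words n (i : 'I_n.+1) m (v K : nat)
    (W : {set {ffun 'I_(m * n.+1) -> 'I_3}}) :
  (forall w, w \in W ->
    (v <= prefix_val (out_digits i (word_seq w)) m <= v + K)%N) ->
  (#|W| <= K.+1 * 3 ^ (m * n))%N.
Proof.
move=> Wv.
pose rest (w : {ffun 'I_(m * n.+1) -> 'I_3}) : {ffun 'I_m * 'I_n -> 'I_3} :=
  [ffun jk : 'I_m * 'I_n => word_seq w (lift i jk.2 + jk.1 * n.+1)%N].
pose code w : 'I_K.+1 * {ffun 'I_m * 'I_n -> 'I_3} :=
  (inord (prefix_val (out_digits i (word_seq w)) m - v), rest w).
have code_inj : {in W &, injective code}.
  move=> w w' Ww Ww' [/(congr1 val)/= + rww'].
  have /andP[v1 K1] := Wv _ Ww; have /andP[v2 K2] := Wv _ Ww'.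
  rewrite !inordK ?ltnS ?leq_subLR// => vE.
  have {}vE : prefix_val (out_digits i (word_seq w)) m =
    prefix_val (out_digits i (word_seq w')) m by lia.
  apply/ffunP => k; rewrite -!word_seqE.
  apply: (@out_digits_inj _ i m) => //; last exact: prefix_val_inj.
  move=> {}k km ki.
  have jm : (k %/ n.+1 < m)%N by have := ltn_ord i; rewrite ltn_divLR.
  have kn : (k %% n.+1 < n.+1)%N by rewrite ltn_mod.
  have [l li] : {l | Ordinal kn = lift i l}.
    case: (unliftP i (Ordinal kn)) => [l ->|/(congr1 val)/= kiE].
      by exists l.
    by rewrite kiE eqxx in ki.
  move/ffunP/(_ (Ordinal jm, l)) : rww'; rewrite !ffunE/=.
  by move/(congr1 val): li => /= <-; rewrite addnC -divn_eq.
rewrite -(card_in_imset code_inj) (leq_trans (max_card _))//.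
by rewrite card_prod card_ffun card_prod !card_ord.
Qed.

Lemma nat_window (R : archiRealFieldType) (x y : R) : x <= y ->
  exists v K : nat,
  K%:R <= y - x + 1 /\ forall k : nat, x <= k%:R <= y -> (v <= k <= v + K)%N.
Proof.
move=> xy; exists (Num.truncn x), (Num.truncn y - Num.truncn x)%N.
have txy := le_truncn xy; rewrite subnKC//; split.
  rewrite natrB//; have := truncnS_gt x; rewrite -natr1.
  have [y0|y0] := leP 0 y.
    by have := truncn_le y; rewrite y0 => yle; lra.
  (* [truncn] vanishes on negative numbers, so the window reduces to 0. *)
  have /truncn0Pn -> : ~~ (1 <= y) by lra.
  by have := ler0n R (Num.truncn x); lra.
move=> k /andP[xk ky]; rewrite truncn_le_nat -natr1.
by rewrite truncn_ge_nat ?ky; [lra|apply: le_trans ky].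
Qed.

(** * Lebesgue outer measure, covers and measurability *)

Section lebesgue_outer_measure.
Context {R : realType}.
Local Notation lambda := ((@wlength R idfun)^*)%mu.

Lemma outer_measure_finite_cover (T : finType) (W : {set T}) (J : T -> set R)
    (e : R) (A : set R) :
  (forall w, lambda (J w) <= e%:E)%E ->
  (forall x, A x -> exists2 w, w \in W & J w x) ->
  (lambda A <= (#|W|%:R * e)%:E)%E.
Proof.
move=> Je AJ; pose U := \big[setU/set0]_(w in W) J w.
apply: (@le_trans _ _ (lambda U)).
  apply: le_outer_measure => x /AJ[w wW Jwx].
  by rewrite /U -bigcup_pred; exists w.
apply: (@le_trans _ _ (\sum_(w in W) e%:E)%E).
  apply: (big_ind2 (fun (X : set R) s => lambda X <= s)%E) => //.
    by rewrite outer_measure0.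
  move=> X s Y u Xs Yu; apply: le_trans (outer_measureU2 _ _ _) _.
  exact: leeD.
by rewrite sumEFin sumr_const mulr_natl.
Qed.

Lemma outer_measure_itvcc (a b : R) : a <= b -> lambda `[a, b] = (b - a)%:E.
Proof.
move=> ab; have /= := @lebesgue_measure_itv R `[a, b].
rewrite lte_fin -EFinB => lE; rewrite [LHS]lE.
by case: ltP => // ba; congr EFin; lra.
Qed.

Lemma outer_measure_le_triadic (A : set R) (x c : R) :
  (forall m, lambda A <= (x + c / 3 ^+ m)%:E)%E -> (lambda A <= x%:E)%E.
Proof.
case: (lambda A) => [r h|/(_ 0%N)|] //; last by rewrite leNye.
by rewrite lee_fin; apply: (@ler_triadicP _ _ _ c) => m; rewrite -lee_fin.
Qed.

(** [lambda A] is an infimum over countable covers by half-open intervals, and such a cover of [A]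
    pulls back to a cover of its preimage. *)
Lemma outer_measure_le_ocitv (f : R -> R) (I : set R) :
  (forall a b : R, a < b ->
    (lambda (I `&` f @^-1` `]a, b]) <= (b - a)%:E)%E) ->
  forall A, (lambda (I `&` f @^-1` A) <= lambda A)%E.
Proof.
move=> fab A; apply: le_ereal_inf_tmp => _ [F [mF AF] <-].
apply: (@le_trans _ _ (\sum_(k <oo) lambda (I `&` f @^-1` F k))%E).
  apply: (@le_trans _ _ (lambda (\bigcup_k (I `&` f @^-1` F k)))); last first.
    exact: outer_measure_sigma_subadditive.
  by apply: le_outer_measure => x [Ix /AF[k _ Fkx]]; exists k.
apply: lee_nneseries => k _; first by move=> _; exact: outer_measure_ge0.
have /ocitvP[->|[[a b]/= ab ->]] := mF k.
  by rewrite preimage_set0 setI0 outer_measure0 wlength0.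
by rewrite wlength_itv/= lte_fin ab -EFinB; exact: fab.
Qed.

(* Let [B] be a Borel set containing [T] with the same outer measure, and cut [E],
   [I `\` E] and [I] along [B]: as the measures are finite and the outer measure
   is subadditive outside [B], the hypothesis on [I] passes to [I `&` B]. *)
Lemma lebesgue_measurable_complemented (I E : set R) :
  lebesgue_measurable I -> (lambda I < +oo)%E -> E `<=` I ->
  (lambda E + lambda (I `\` E) <= lambda I)%E -> lebesgue_measurable E.
Proof.
move=> mI Ioo EI Ele; apply: le_caratheodory_measurable => T.
have fin A : A `<=` I -> lambda A \is a fin_num.
  move=> AI; rewrite ge0_fin_numE ?outer_measure_ge0//.
  by apply: le_lt_trans Ioo; exact: le_outer_measure.
have [G [oG TG GT]] := outer_measure_Gdelta T.
set B := \bigcap_i G i in TG GT.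
have mB : lebesgue_measurable B.
  apply: sub_caratheodory; apply: bigcapT_measurable => k.
  exact: open_measurable.
rewrite -[leRHS]GT.
have split_B A : lambda A = (lambda (A `&` B) + lambda (A `&` ~` B))%E := mB A.
have split_I A : lambda A = (lambda (A `&` I) + lambda (A `&` ~` I))%E := mI A.
have IB_le C : (lambda (I `&` C) <=
    lambda (E `&` C) + lambda ((I `\` E) `&` C))%E.
  apply: le_trans (outer_measureU2 _ _ _); apply: le_outer_measure => x [Ix Cx].
  by have [Ex|nEx] := pselect (E x); [left|right].
have E_IB : (lambda (E `&` B) + lambda ((I `\` E) `&` B) <= lambda (I `&` B))%E.
  move: Ele; rewrite (split_B E) (split_B (I `\` E)) (split_B I).
  have := IB_le (~` B).
  have fE C : lambda (E `&` C) \is a fin_num by apply: fin => x [/EI].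
  have fIE C : lambda ((I `\` E) `&` C) \is a fin_num by apply: fin => x [[]].
  have fI C : lambda (I `&` C) \is a fin_num by apply: fin => x [].
  rewrite -(fineK (fE B)) -(fineK (fIE B)) -(fineK (fI B)).
  rewrite -(fineK (fE (~` B))) -(fineK (fIE (~` B))) -(fineK (fI (~` B))).
  rewrite -!EFinD !lee_fin; lra.
rewrite [leRHS](split_I B) (setIC B I).
apply: (@le_trans _ _ (lambda (E `&` B) +
    (lambda ((I `\` E) `&` B) + lambda (B `&` ~` I)))%E).
  apply: leeD; first by apply: le_outer_measure => x [/TG].
  apply: le_trans (outer_measureU2 _ _ _).
  apply: le_outer_measure => x [/TG Bx].
  by have [Ix|nIx] := pselect (I x); [left|right].
by rewrite addeA; apply: leeD.
Qed.

Lemma outer_measure_itv01 : lambda `[0%R, 1%R] = 1%E.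
Proof. by rewrite outer_measure_itvcc// subr0. Qed.

Lemma uniformly_distributed_ocitv (f : R -> R) :
  (forall t, t \in `[0, 1] -> f t \in `[0, 1]) ->
  (forall a b : R, a < b ->
    (lambda (`[0%R, 1%R] `&` f @^-1` `]a, b]) <= (b - a)%:E)%E) ->
  uniformly_distributed f.
Proof.
move=> f01 fab A A01 mA; set I := `[0, 1]%classic; set E := I `&` f @^-1` A.
have fle := outer_measure_le_ocitv fab.
have I1 : lambda I = 1%E := outer_measure_itv01.
have mI : lebesgue_measurable I.
  by apply: sub_caratheodory; exact: measurable_itv.
have AI : (lambda A + lambda (I `\` A) = 1)%E.
  rewrite -I1 (mA I) setIC; congr (lambda _ + _)%E.
  by apply/seteqP; split => [x Ax|x []//]; split=> //; exact: A01.
(* As [f] maps [I] into itself, [f] sends the points of [I] outside [E] into [I] minus [A]. *)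
have Ele : (lambda (I `\` E) <= lambda (I `\` A))%E.
  apply: le_trans (fle _); apply: le_outer_measure => x [Ix nEx]; split => //.
  by split; [exact: f01|move=> Ax; apply: nEx].
have EIE : (1 <= lambda E + lambda (I `\` E))%E.
  rewrite -I1; apply: le_trans (outer_measureU2 _ _ _).
  by apply: le_outer_measure => x Ix; have [|] := pselect (E x); [left|right].
split.
  apply: (lebesgue_measurable_complemented mI); rewrite ?I1 ?ltry//.
    by move=> x [].
  by rewrite -AI; apply: leeD => //; exact: fle.
apply/le_anti/andP; split; first exact: fle.
rewrite -(@leeD2rE _ (lambda (I `\` A))).
  rewrite [leLHS]AI; apply: le_trans EIE _; exact: leeD2l.
rewrite ge0_fin_numE ?outer_measure_ge0// (@le_lt_trans _ _ 1%E) ?ltry//.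
by rewrite -I1; apply: le_outer_measure => x [].
Qed.

End lebesgue_outer_measure.

(** * Coordinates of the Peano curve *)

Lemma Phi_itv (R : realType) (d : ternary_seq) : Phi R d \in `[0, 1].
Proof. by have := Phi_bounds R d 0; rewrite in_itv/= expr0 !divr1. Qed.

(** By [Phi_surj] a representation exists, so on the unit interval [xget] never returns its
    default. *)
Lemma peano_curve_coord (R : realType) n (i : 'I_n) (t : R) : t \in `[0, 1] ->
  exists2 s, Phi R s = t & peano_curve n t ord0 i = Phi R (out_digits i s).
Proof.
move=> /Phi_surj[d dt]; exists (xget (fun=> ord0) (ternary_repr t)).
  by apply: (@xgetPex _ _ (ternary_repr t)); exists d.
by rewrite mxE.
Qed.

Lemma peano_curve_le_ocitv (R : realType) n (i : 'I_n) (a b : R) : a < b ->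
  ((@wlength R idfun)^*%mu
    (`[0%R, 1%R] `&` (fun t => peano_curve n t ord0 i) @^-1` `]a, b]) <=
   (b - a)%:E)%E.
Proof.
case: n i => [[]//|n] i ab.
(* The 3 collects three units of slack: one from widening the window below, one from [nat_window],
   one from counting [K.+1] values. *)
apply: (@outer_measure_le_triadic _ _ _ 3) => m.
have p3 k : 0 < 3 ^+ k :> R by rewrite exprn_gt0.
(* The prefix value of an output can fall short of [3 ^+ m] times that output by up to 1, hence the
   [- 1] at the lower end. *)
have [|v [K [Kab vK]]] := @nat_window R (a * 3 ^+ m - 1) (b * 3 ^+ m).
  by have := p3 m; nra.
pose out (w : {ffun 'I_(m * n.+1) -> 'I_3}) :=
  prefix_val (out_digits i (word_seq w)) m.
pose W := [set w | a * 3 ^+ m - 1 <= (out w)%:R <= b * 3 ^+ m]%SET.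
pose J (w : {ffun 'I_(m * n.+1) -> 'I_3}) : set R :=
  let p := prefix_val (word_seq w) (m * n.+1) in
  `[p%:R / 3 ^+ (m * n.+1), p.+1%:R / 3 ^+ (m * n.+1)]%classic.
have cardW : (#|W| <= K.+1 * 3 ^ (m * n))%N.
  by apply: (@card_words _ i _ v) => w; rewrite inE; exact: vK.
apply: (@le_trans _ _ (#|W|%:R * 3 ^- (m * n.+1))%:E); last first.
  rewrite lee_fin.
  apply: (@le_trans _ _ ((K.+1 * 3 ^ (m * n))%:R / 3 ^+ (m * n.+1))).
    by rewrite ler_wpM2r ?ler_nat// invr_ge0 ltW.
  rewrite mulnS exprD ler_pdivrMr ?mulr_gt0// natrM natrX mulrA.
  rewrite ler_wpM2r ?(ltW (p3 _))// mulrDl divfK ?gt_eqF// -natr1.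
  by lra.
apply: (@outer_measure_finite_cover _ _ W J) => [w|t [t01 /= ft]].
  rewrite outer_measure_itvcc ?lee_fin; last first.
    by rewrite ler_wpM2r ?ler_nat// invr_ge0 ltW.
  by rewrite -mulrBl -natr1 addrAC subrr add0r mul1r.
have [s st fs] := peano_curve_coord i t01.
pose w : {ffun 'I_(m * n.+1) -> 'I_3} := [ffun k => s (val k)].
have ws k : (k < m * n.+1)%N -> word_seq w k = s k.
  by move=> km; rewrite -[k]/(val (Ordinal km)) word_seqE ffunE.
exists w; last first.
  by rewrite /J /= (eq_prefix_val ws) in_itv/= -st Phi_bounds.
rewrite inE /out (eq_prefix_val (out_digits_congr i ws)).
move: ft; rewrite fs in_itv/= => /andP[aF Fb].
have /andP[] := Phi_bounds R (out_digits i s) m.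
rewrite ler_pdivrMr// ler_pdivlMr// -(natr1 (prefix_val _ _)) => lo hi.
have {}aF := ler_wpM2r (ltW (p3 m)) (ltW aF).
have {}Fb := ler_wpM2r (ltW (p3 m)) Fb.
by lra.
Qed.

Theorem theorem3 (R : realType) (n : nat) (hn : (2 <= n)%N) (i : 'I_n) :
  uniformly_distributed (fun t : R => peano_curve n t ord0 i).
Proof.
apply: uniformly_distributed_ocitv; last exact: peano_curve_le_ocitv.
by move=> t /(peano_curve_coord i)[s _ ->]; exact: Phi_itv.
Qed.
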